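(* Let $\ell$ be a positive integer and suppose $2\ell=pq+r$ for positive integers $p,q$ and an integer $r$ with $p/2\le r\le 20$. Then for every $S\subseteq D_{8\ell+2}\setminus\{e\}$ with $|S|=8\ell$ such that the unique non-identity element of $D_{8\ell+2}$ not in $S$ has the same order as $u^{2\ell-p+1}$, the group $D_{8\ell+2}$ has an $S$-sequencing.
   Context: $D_{2m}=\langle u,v : u^m=e=v^2,\ vu=u^{m-1}v\rangle$ is the dihedral group of order $2m$. For $S\subseteq G\setminus\{e\}$ with $|S|=k$, an $S$-sequencing of $G$ is an ordering $(g_1,\dots,g_k)$ of the elements of $S$ such that the partial products $h_0=e$, $h_i=g_1\cdots g_i$ ($1\le i\le k$) are pairwise distinct. *)

(* Defs.v *)
From mathcomp Require Import all_boot all_order all_algebra all_fingroup.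
Set Implicit Arguments. Unset Strict Implicit. Unset Printing Implicit Defensive.

Definition partial_prod (gT : finGroupType) (s : seq gT) (i : nat) : gT :=
  (\prod_(x <- take i s) x)%g.

Definition is_S_sequencing (gT : finGroupType) (S : {set gT}) (s : seq gT) : Prop :=
  [/\ uniq s, [set x in s] = S &
      uniq [seq partial_prod s i | i <- iota 0 (size s).+1]].

Definition has_S_sequencing (gT : finGroupType) (S : {set gT}) : Prop :=
  exists s : seq gT, is_S_sequencing S s.

Definition is_dihedral (gT : finGroupType) (G : {group gT}) (m : nat) (u v : gT) : Prop :=
  [/\ G :=: <<[set u; v]>>%g, #[u]%g = m, #[v]%g = 2,
      (v * u = u ^+ m.-1 * v)%g & #|G| = (2 * m)%N].

(* Main.v *)
Require Import Defs.
From mathcomp Require Import all_boot all_order all_algebra all_fingroup.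
From mathcomp Require Import cyclic zify ring.
Set Implicit Arguments. Unset Strict Implicit. Unset Printing Implicit Defensive.
Import GRing.Theory.

(** A sequencing of [S = G \ {1, w}] is, up to left translation, a path through
all but one of the elements of [G] whose consecutive quotients avoid [w] and are
pairwise distinct.  Put [n = 2l], [m = 2n + 1].  Squaring is an automorphism of
[<[u]>], so [u ^+ (n - p + 1)] and [u ^+ (2p - 1)] have the same order, and every
element of that order is [(u1 ^+ (2p - 1)) ^ (+-1)] for some other generator
[u1] of [<[u]>].  It therefore suffices to make a path that misses the rotation
[2p - 1] or its inverse (rotations being labelled by exponents of [u1]).

For [p = 1] there is an explicit path: a zigzag through half of the rotations,
a walk alternating between rotations and reflections, and a zigzag through half
of the reflections.  Its two junctions lie near the labels 0 and -1, and so do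
all edges with small labels.  For [p <> 2] it is enough to reroute the path near
the two junctions, by a finite pattern that does not depend on [l] (found by
computer search, and fitting in as soon as [3p <= 2n]).  For [p = 2] no
small pattern was found; instead the alternating walk is permuted in
consecutive blocks of four vertices. *)

(** * Paths and their consecutive quotients *)

Definition vertex := (bool * int)%type.

(* The label of the quotient [a^-1 * b], see [vert_quotient]. *)
Definition edge (a b : vertex) : vertex :=
  (a.1 (+) b.1, if a.1 == b.1 then b.2 - a.2 else - (a.2 + b.2))%R.

Definition edges (s : seq vertex) : seq vertex :=
  if s is a :: s' then pairmap edge a s' else [::].

Definition quotients (gT : finGroupType) (s : seq gT) : seq gT :=
  if s is x :: s' then pairmap (fun y z => y^-1 * z)%g x s' else [::].

Section Quotients.

Variable gT : finGroupType.
Implicit Types (x y : gT) (s A B C W : seq gT).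
Local Open Scope group_scope.

Lemma quotients_cat A x W C :
  quotients (A ++ x :: W ++ C) =
  quotients (rcons A x) ++ quotients (x :: W) ++ quotients (last x W :: C).
Proof.
case: A => [|a A] /=; first by rewrite pairmap_cat.
by rewrite pairmap_cat /= pairmap_cat -cats1 pairmap_cat /= -!catA.
Qed.

Lemma quotients_cat2 A x W B y W' C :
  quotients (A ++ (x :: W) ++ B ++ (y :: W') ++ C) =
  quotients (rcons A x) ++ quotients (x :: W) ++
    quotients (rcons (last x W :: B) y) ++ quotients (y :: W') ++
    quotients (last y W' :: C).
Proof. by rewrite quotients_cat -cat_cons quotients_cat. Qed.

Lemma size_quotients s : size (quotients s) = (size s).-1.
Proof. by case: s => //= x s; rewrite size_pairmap. Qed.

(** The product telescopes. *)
Lemma partial_prod_quotients x s i : i <= size s ->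
  partial_prod (quotients (x :: s)) i = x^-1 * nth 1 (x :: s) i.
Proof.
rewrite /partial_prod /=.
elim: s x i => [|y s IHs] x [|i] //= le_i; rewrite ?big_nil ?mulVg //.
by rewrite big_cons IHs // mulgA mulgK.
Qed.

Lemma quotients_in (G : {group gT}) s :
  {subset s <= G} -> {subset quotients s <= G}.
Proof.
case: s => // x s; elim: s x => //= y s IHs x sG z.
have xG : x \in G by apply: sG; rewrite mem_head.
have yG : y \in G by apply: sG; rewrite !inE eqxx orbT.
rewrite inE => /predU1P[-> | zs]; first by rewrite groupM ?groupV.
by apply: (IHs y) => // t ts; apply: sG; rewrite inE ts orbT.
Qed.

Lemma quotients_neq1 s : uniq s -> 1 \notin quotients s.
Proof.
case: s => // x s; elim: s x => //= y s IHs x /andP[xs us].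
rewrite inE negb_or IHs // andbT; apply: contra xs => /eqP e1.
have -> : x = y by apply/eqP; rewrite eq_mulVg1 -e1.
exact: mem_head.
Qed.

(** The |S| quotients are distinct and differ from 1 and [w], so they exhaust [S]. Their partial
    products are a left translate of the path, hence distinct. *)
Lemma sequencing_of_path (G : {group gT}) (S : {set gT}) w s :
  S \subset G -> 1 \notin S -> w \notin S -> size s = #|S|.+1 ->
  #|G| = #|S|.+2 -> {subset s <= G} -> uniq s -> w \in G -> w != 1 ->
  uniq (w :: quotients s) -> has_S_sequencing S.
Proof.
move=> sSG S1 Sw szs cG sG us wG w1 /andP[wq uq].
have eS : S = G :\ 1 :\ w.
  apply/eqP; rewrite eqEcard; apply/andP; split.
    apply/subsetP=> x xS; rewrite !inE (subsetP sSG) // andbT.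
    by rewrite (memPn Sw) ?(memPn S1).
  have := cardsD1 1 G; have := cardsD1 w (G :\ 1).
  rewrite !inE group1 wG w1 cG /= => e1 [].
  by rewrite e1 => -[->].
exists (quotients s); split=> //.
  apply/eqP; rewrite eqEcard; apply/andP; split.
    apply/subsetP=> x; rewrite inE eS !inE => xq.
    rewrite (quotients_in sG) // andbT (memPn wq) //.
    exact: (memPn (quotients_neq1 us)).
  by rewrite cardsE (card_uniqP uq) size_quotients szs.
case: s szs {sG} us {wq uq} => // x s szs us.
rewrite size_quotients [(size _).-1.+1]/=.
have -> : [seq partial_prod (quotients (x :: s)) i | i <- iota 0 (size s).+1]
          = [seq x^-1 * y | y <- x :: s].
  apply: (@eq_from_nth _ 1) => [|i]; rewrite !size_map size_iota // => lt_i.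
  rewrite (nth_map 0%N) ?size_iota // nth_iota // add0n.
  by rewrite partial_prod_quotients // (nth_map 1 _ _ (s := x :: s)).
by rewrite map_inj_uniq //; apply: mulgI.
Qed.

End Quotients.

(** * Integer labels for the elements of a dihedral group *)

Lemma power_inverted (gT : finGroupType) (u v : gT) k :
  (v * u = u^-1 * v)%g -> (v * u ^+ k = (u ^+ k)^-1 * v)%g.
Proof.
move=> vuv; elim: k => [|k IHk]; first by rewrite invg1 mul1g mulg1.
by rewrite expgSr mulgA IHk -mulgA vuv mulgA -invMg -expgS expgSr.
Qed.


Section Dihedral.

Variables (gT : finGroupType) (u v : gT) (m : nat).
Implicit Types z t : int.
Hypothesis m_gt0 : 0 < m.
Local Open Scope group_scope.
Hypothesis um : u ^+ m = 1.
Hypothesis vv : v * v = 1.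
Hypothesis vuv : v * u = u^-1 * v.

Definition upow (z : int) : gT := u ^+ `|(z %% m)%Z|%N.

Definition delt (d : vertex) : gT := if d.1 then upow d.2 * v else upow d.2.

(* A reflection vertex [(true, z)] stands for [u ^ (- z) v]: with this sign a
   quotient of two vertices depends on the difference or on the sum of their
   labels only. *)
Definition vert (a : vertex) : gT := delt (a.1, if a.1 then - a.2 else a.2)%R.

Lemma upow_nat k : upow k%:Z = u ^+ k.
Proof. by rewrite /upow modz_nat absz_nat expg_mod. Qed.

Lemma upow_mod z t : (m%:Z %| (z - t)%R)%Z -> upow z = upow t.
Proof. by rewrite -eqz_mod_dvd /upow => /eqP->. Qed.

Lemma upow_rep z : exists2 k : nat, upow z = u ^+ k & (m%:Z %| (z - k%:Z)%R)%Z.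
Proof.
exists `|(z %% m)%Z|%N => //; rewrite -eqz_mod_dvd gez0_abs ?modz_mod //.
by rewrite modz_ge0 // -lt0n.
Qed.

Lemma upowD z t : upow (z + t)%R = upow z * upow t.
Proof.
have [[i -> hi] [j -> hj]] := (upow_rep z, upow_rep t).
rewrite -expgD -upow_nat; apply: upow_mod.
have -> : (z + t - (i + j)%N%:Z = (z - i%:Z) + (t - j%:Z))%R by lia.
exact: rpredD.
Qed.

Lemma upow0 : upow 0%R = 1. Proof. exact: (upow_nat 0). Qed.

Lemma upowN z : upow (- z)%R = (upow z)^-1.
Proof. by apply/eqP; rewrite eq_sym eq_invg_mul -upowD subrr upow0. Qed.

Lemma v_upow z : v * upow z = upow (- z)%R * v.
Proof.
by rewrite upowN; have [k -> _] := upow_rep z; apply: power_inverted.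
Qed.

Lemma vert_quotient a b : (vert a)^-1 * vert b = delt (edge a b).
Proof.
have vV : v^-1 = v by apply/eqP; rewrite eq_invg_mul vv.
case: a b => [[] z] [[] t]; rewrite /vert /delt /edge /= ?invMg ?vV.
- rewrite -mulgA (mulgA _ _ v) -upowN -upowD mulgA v_upow -mulgA vv mulg1.
  by congr upow; ring.
- by rewrite -upowN -mulgA -upowD v_upow; congr (upow _ * v); ring.
- by rewrite -upowN mulgA -upowD; congr (upow _ * v); ring.
- by rewrite -upowN -upowD addrC.
Qed.

Lemma quotients_vert s : quotients (map vert s) = map delt (edges s).
Proof.
case: s => //= a s; elim: s a => //= b s IHs a.
by rewrite vert_quotient IHs.
Qed.

Lemma vert_mod b z t : (m%:Z %| (z - t)%R)%Z -> vert (b, z) = vert (b, t).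
Proof.
move=> mzt; rewrite /vert /delt; case: b => /=; last exact: upow_mod.
by congr (_ * v); apply: upow_mod; rewrite -opprD rpredN.
Qed.

Lemma delt_mod b z t : (m%:Z %| (z - t)%R)%Z -> delt (b, z) = delt (b, t).
Proof. by move=> mzt; rewrite /delt (upow_mod mzt). Qed.

End Dihedral.

(** * Paths missing one vertex and one quotient, and exchange of windows *)

Section NearPerfect.

Variables (gT : finGroupType) (G : {group gT}).
Implicit Types (s A B C W V : seq gT).

(** A path on all elements but [z] has |G| - 2 quotients, none of them 1; being distinct and
    different from [w], they are all the other elements. *)
Definition near_perfect (w z : gT) s :=
  perm_eq (z :: s) (enum G) && uniq (w :: quotients s).

(** Each new piece keeps the first and last vertex of the old one, so the quotients outside the
    windows do not change. Only the joint content of both windows matters: vertices and quotients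
    may migrate from one window to the other. *)
Lemma near_perfect_swap A x W V B y W' V' C w z w' z' :
  last x V = last x W -> last y V' = last y W' ->
  perm_eq (z' :: (x :: V) ++ (y :: V')) (z :: (x :: W) ++ (y :: W')) ->
  perm_eq (w' :: quotients (x :: V) ++ quotients (y :: V'))
          (w :: quotients (x :: W) ++ quotients (y :: W')) ->
  near_perfect w z (A ++ (x :: W) ++ B ++ (y :: W') ++ C) ->
  near_perfect w' z' (A ++ (x :: V) ++ B ++ (y :: V') ++ C).
Proof.
rewrite /near_perfect !quotients_cat2 => -> -> /seq.permP pv /seq.permP pq.
case/andP=> pG uq; apply/andP; split; last first.
  apply: etrans uq; apply: perm_uniq; apply/seq.permP => a.
  have := pq a; rewrite [count _ _]/= [in RHS]/=.
  by rewrite ![count _ (_ :: _)]/= !count_cat; lia.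
apply: perm_trans pG; apply/seq.permP => a.
by have := pv a; rewrite /= !count_cat /= !count_cat /= !count_cat; lia.
Qed.

Lemma near_perfect_sequencing (S : {set gT}) w z s :
  S \subset G -> 1%g \notin S -> w \in G -> w != 1%g -> w \notin S ->
  #|G| = #|S|.+2 -> near_perfect w z s -> has_S_sequencing S.
Proof.
move=> sSG S1 wG w1 Sw cG /andP[pG uq].
have szs : size s = #|S|.+1 by have := perm_size pG; rewrite -cardE cG => -[].
apply: (sequencing_of_path sSG S1 Sw szs cG _ _ wG w1 uq).
  by move=> x xs; rewrite -mem_enum -(perm_mem pG) inE xs orbT.
by have := perm_uniq pG; rewrite enum_uniq => /andP[].
Qed.

End NearPerfect.

(* The three parts of the path, [xlab] being run through backwards: 0, 1, -2, 3,
   ... on rotations; 0, 0, 2, 2, 4, 4, ... on rotations and reflections in turn;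
   -4, 1, -6, 3, ... on reflections.  The zigzags yield
   the odd differences, one sign of each from [xlab] and the other from [ylab],
   except for 1; sums along [alab] are even.  Modulo [m = 2n + 1] these
   represent all residues. *)
Definition xlab (i : nat) : vertex := (false, if odd i then i%:Z else - i%:Z)%R.
Definition alab (j : nat) : vertex := (odd j, Posz j./2.*2).
Definition ylab (i : nat) : vertex :=
  (true, if odd i then - (i + 3)%:Z else i%:Z - 1)%R.

Definition blab (n j : nat) : vertex :=
  if j <= n then xlab (n - j)
  else if j <= (3 * n).+1 then alab (j - n) else ylab (j - (3 * n).+1).

Definition base (n : nat) : seq vertex := [seq blab n j | j <- iota 0 (4 * n).+1].

Lemma blab_x n i : i <= n -> blab n (n - i) = xlab i.
Proof. by rewrite /blab leq_subr => /subKn->. Qed.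

Lemma blab_a n i : i <= n.*2.+1 -> blab n (n + i) = alab i.
Proof.
case: i => [|i] le_i; first by rewrite addn0 /blab leqnn subnn.
rewrite /blab addKn; case: ifP => [|_]; first by lia.
by case: ifP => //; lia.
Qed.

Lemma blab_y n i : 0 < i -> blab n ((3 * n).+1 + i) = ylab i.
Proof.
move=> i_gt0; rewrite /blab addKn; case: ifP => [|_]; first by lia.
by case: ifP => //; lia.
Qed.

Lemma edges_iota (f : nat -> vertex) a k :
  edges [seq f j | j <- iota a k.+1] = [seq edge (f j) (f j.+1) | j <- iota a k].
Proof. by elim: k a => //= k IHk a; rewrite -IHk. Qed.

(** Pigeonhole: for [base] it is then enough to show that every vertex and every quotient occurs,
    and to count. *)
Lemma leq_size_uniq_card (gT : finGroupType) (A : {set gT}) (s : seq gT) :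
  {subset A <= s} -> size s <= #|A| -> uniq s.
Proof.
move=> sAs szs; apply: (leq_size_uniq (enum_uniq (mem A))).
  by move=> x; rewrite mem_enum; apply: sAs.
by rewrite -cardE.
Qed.

(** * The explicit path misses only the rotation 1 *)

Section Base.

Variables (gT : finGroupType) (G : {group gT}) (u v : gT) (n : nat).
Let m := (n.*2).+1.
Hypothesis n_gt1 : 1 < n.
Hypothesis n_even : ~~ odd n.
Local Open Scope group_scope.
Hypothesis um : u ^+ m = 1.
Hypothesis vv : v * v = 1.
Hypothesis vuv : v * u = u^-1 * v.
Hypothesis Guv : forall x, x \in G -> exists d : vertex, x = delt u v m d.
Hypothesis cG : #|G| = (2 * m)%N.

Local Notation vert := (vert u v m).
Local Notation delt := (delt u v m).

Lemma vert_eq b (z t : int) : (exists k : int, z = t + k * m%:Z)%R ->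
  vert (b, z) = vert (b, t).
Proof.
case=> k ->; apply: vert_mod; have -> : (t + k * m%:Z - t = k * m%:Z)%R by ring.
exact: dvdz_mull.
Qed.

Lemma delt_eq b (z t : int) : (exists k : int, z = t + k * m%:Z)%R ->
  delt (b, z) = delt (b, t).
Proof.
case=> k ->; apply: delt_mod; have -> : (t + k * m%:Z - t = k * m%:Z)%R by ring.
exact: dvdz_mull.
Qed.

Lemma int_mod_rep (z : int) :
  exists2 i : nat, i < m & exists k : int, (z = i%:Z + k * m%:Z)%R.
Proof.
exists `|(z %% m%:Z)%Z|%N.
  by rewrite -ltz_nat gez0_abs ?modz_ge0 // ltz_pmod.
exists (z %/ m%:Z)%Z.
by rewrite gez0_abs ?modz_ge0 // addrC -divz_eq.
Qed.

Lemma base_vertices x : x \in G ->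
  x \in vert (true, -2)%R :: [seq vert a | a <- base n].
Proof.
case/Guv => -[b d] ->.
have [t et] : exists t : int, delt (b, d) = vert (b, t).
  exists (if b then - d else d)%R; rewrite /vert.
  by case: b; rewrite //= opprK.
rewrite {}et {d}; have [i lt_i [k ->]] := int_mod_rep t.
rewrite (@vert_eq _ _ (Posz i)); last by exists k.
(* It remains to name, for each residue [i], a position [j] whose label is congruent to [i]. *)
have key j t' : blab n j = (b, t') -> j <= 4 * n ->
    (exists k' : int, i%:Z = t' + k' * m%:Z)%R ->
    vert (b, Posz i) \in vert (true, -2)%R :: [seq vert a | a <- base n].
  move=> ej le_j /vert_eq->; rewrite inE -ej; apply/orP; right.
  by apply/map_f/map_f; rewrite mem_iota; lia.
case: b key => key; have [odd_i | ev_i] := boolP (odd i).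
(* Odd reflections: small [i] occur in [ylab] as [i], large ones as i - m. The value n - 1 is the
   final vertex, labelled -(n + 2), and 2n - 1 is the skipped vertex -2. *)
- have [le_i|lt_n] := leqP i n.-2.
    apply: (key ((3 * n).+1 + i.+1) (Posz i)); last by exists 0%R; lia.
      by rewrite blab_y // /ylab /= odd_i; congr pair; lia.
    lia.
  have [eq_i|ne_i] := eqVneq i n.-1.
    apply: (key ((3 * n).+1 + n.-1) (- (n + 2)%:Z)%R).
    - rewrite blab_y ?/ylab; last by lia.
      have -> : odd n.-1 by lia.
      by congr pair; lia.
    - lia.
    - by exists 1%R; lia.
  have [eq_m|ne_m] := eqVneq i n.*2.-1.
    rewrite (@vert_eq _ _ (-2)%R) ?mem_head //.
    by exists 1%R; lia.
  apply: (key ((3 * n).+1 + (n.*2 - 2 - i)) (i%:Z - m%:Z)%R).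
  - rewrite blab_y ?/ylab; last by lia.
    have -> : odd (n.*2 - 2 - i) by lia.
    by congr pair; lia.
  - lia.
  - by exists 1%R; lia.
- apply: (key (n + i.+1) (Posz i)); last by exists 0%R; lia.
    rewrite blab_a /alab; last by lia.
    by congr pair; lia.
  lia.
- have [le_i|lt_n] := leqP i n.
    apply: (key (n - i) (Posz i)); last by exists 0%R; lia.
      by rewrite blab_x // /xlab odd_i.
    lia.
  apply: (key (n - (m - i)) (i%:Z - m%:Z)%R).
  - rewrite blab_x ?/xlab; last by lia.
    have -> : odd (m - i) = false by lia.
    by congr pair; lia.
  - lia.
  - by exists 1%R; lia.
- apply: (key (n + i) (Posz i)); last by exists 0%R; lia.
    rewrite blab_a /alab; last by lia.
    by congr pair; lia.
  lia.
Qed.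

Lemma base_quotients x : x \in G -> x != 1 ->
  x \in delt (false, 1)%R :: [seq delt d | d <- edges (base n)].
Proof.
case/Guv => -[b d] ->; have [i lt_i [k ->]] := int_mod_rep d.
rewrite (@delt_eq _ _ (Posz i)); last by exists k.
have key j c t' : edge (blab n j) (blab n j.+1) = (c, t') -> c = b -> j < 4 * n ->
    (exists k' : int, i%:Z = t' + k' * m%:Z)%R ->
    delt (b, Posz i) \in delt (false, 1)%R :: [seq delt d | d <- edges (base n)].
  move=> ej <- le_j /delt_eq->; rewrite inE -ej; apply/orP; right.
  rewrite /base edges_iota; apply: map_f; apply: (map_f (fun j => edge _ _)).
  by rewrite mem_iota; lia.
case: b key => key i1.
  (* 2 is invertible modulo [m], so -2a = i can be solved; 2a is the sum of the labels of [alab a]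
     and [alab a.+1]. *)
  have [a [le_a [k' ek]]] : exists a : nat, a <= n.*2 /\
      exists k' : int, (i%:Z = - (a.*2)%:Z + k' * m%:Z)%R.
    have [odd_i|ev_i] := boolP (odd i).
      by exists ((m - i)./2); split; [lia | exists 1%R; lia].
    have [->|i_neq0] := eqVneq i 0%N.
      by exists 0%N; split=> //; exists 0%R; lia.
    by exists (m - i./2); split; [lia | exists 2%R; lia].
  apply: (key (n + a) true (- (a.*2)%:Z)%R) => //; last by exists k'.
    rewrite -addnS !blab_a /alab /edge /=; [|lia..].
    by case: (odd a) => /=; congr pair; lia.
  lia.
have i_gt0 : 0 < i.
  by rewrite lt0n; apply: contraNneq i1 => ->; rewrite /delt /= upow0.
(* [e] is the odd representative of [i] between -m and m, and |e| = 2t + 1. For given [t], the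
   zigzag [xlab] yields the positive sign when [t] is odd, [ylab] when [t] is even. *)
pose e : int := (if odd i then i%:Z else i%:Z - m%:Z)%R.
have ee : exists k' : int, (i%:Z = e + k' * m%:Z)%R.
  by rewrite /e; case: ifP => _; [exists 0%R | exists 1%R]; lia.
pose t := if odd i then i./2 else (m - i)./2.
have lt_t : t < n by rewrite /t; case: ifP; lia.
have e_t : (e = if odd i then (t.*2.+1)%:Z else - (t.*2.+1)%:Z)%R.
  by rewrite /e /t; case: ifP; lia.
have t_i : i = 1%N \/ 0 < t \/ ~~ odd i by rewrite /t; case: ifP; lia.
have e_i : (e = if odd i then i%:Z else i%:Z - m%:Z)%R by [].
clearbody e t.
have [ei|ne_i] := eqVneq i 1%N; first by rewrite ei mem_head.
have [dX|dY] := eqVneq (odd i) (odd t).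
  apply: (key (n - t.+1) false e) => //.
    have -> : (n - t.+1).+1 = n - t by lia.
    rewrite !blab_x /xlab /edge /=; [|lia..].
    by congr pair; rewrite e_t dX; case: (odd t) => /=; lia.
  lia.
have t_gt0 : 0 < t by lia.
(* For t = 1 the edge starts at the junction, which the path lists as [alab n.*2.+1] with label 2n
   in place of -1, the label of [ylab 0]. *)
have [t1|t_gt1] := leqP t 1%N.
  have {t1 t_gt0} t1 : t = 1%N by lia.
  apply: (key (3 * n).+1 false (- (n.*2 + 4)%:Z)%R) => //; last first.
  - by exists 2%R; move: dY e_t e_i; rewrite t1; case: ifP; lia.
  - lia.
  have := blab_y n (isT : 0 < 1)%N; rewrite addn1 => ->.
  have -> : blab n (3 * n).+1 = alab n.*2.+1.
    by rewrite -(@blab_a n) //; congr blab; lia.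
  by rewrite /edge /alab /ylab /= odd_double /=; congr pair; lia.
apply: (key ((3 * n).+1 + t.-1) false e) => //; last by lia.
have -> : ((3 * n).+1 + t.-1).+1 = (3 * n).+1 + t by lia.
rewrite !blab_y /ylab /edge /=; [|lia..].
have -> : odd t.-1 = ~~ odd t by lia.
by congr pair; rewrite e_t; move: dY; case: (odd i) (odd t) => -[] //= _; lia.
Qed.

Lemma base_near_perfect :
  near_perfect G (delt (false, 1)%R) (vert (true, -2)%R)
    [seq vert a | a <- base n].
Proof.
rewrite /near_perfect (quotients_vert _ um) //; apply/andP; split.
  have sz : size (vert (true, -2)%R :: [seq vert a | a <- base n]) = #|G|.
    by rewrite /= !size_map size_iota cG /m; lia.
  apply: uniq_perm (enum_uniq _) _.
    by apply: (leq_size_uniq_card base_vertices); rewrite sz.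
  have [] := @uniq_min_size _ (enum G) (vert (true, -2)%R :: map vert (base n)).
  - exact: enum_uniq.
  - by move=> x; rewrite mem_enum; apply: base_vertices.
  - by rewrite sz cardE.
  by move=> _ eG x; rewrite eG.
apply: (@leq_size_uniq_card _ (G :\ 1)).
  by move=> x; rewrite !inE => /andP[x1 xG]; apply: base_quotients.
have := cardsD1 1 G; rewrite group1 cG add1n => -[<-].
have szq : size [seq delt d | d <- edges (base n)] = (4 * n)%N.
  by rewrite /base edges_iota !size_map size_iota.
rewrite -[size _]/(size [seq delt d | d <- edges (base n)]).+1 szq.
by rewrite /m; lia.
Qed.

End Base.

(* The end of [alab], read backwards and with labels reduced modulo [2n + 1]. *)
Definition tlab (i : nat) : vertex := (~~ odd i, - 1 - (i./2.*2)%:Z)%R.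

(** * Local rerouting for p <> 2 *)

Definition window1 (a h : nat) : seq vertex :=
  rev [seq xlab i | i <- iota 0 a.+1] ++ [seq alab i | i <- iota 1 h].

(** [tlab 0] is [ylab 0], just as [xlab 0] is [alab 0]; the second half of each window starts at
    index 1 so that the junction is listed once. *)
Definition window2 (b c : nat) : seq vertex :=
  rev [seq tlab i | i <- iota 0 b.+1] ++ [seq ylab i | i <- iota 1 c].

(* [g_path1] and [g_path2] replace the pieces [window1 g_x g_h] and
   [window2 g_t g_y] of the path around its junctions; afterwards the vertex
   [g_skipped] is unused and the rotation [g_missed] is not a quotient. *)
Record gadget := Gadget {
  g_x : nat; g_h : nat; g_t : nat; g_y : nat;
  g_missed : int; g_skipped : vertex;
  g_path1 : seq vertex; g_path2 : seq vertex }.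

(** The permutations hold between integer labels, so they survive reduction modulo every 2n + 1;
    reflection -2 and rotation 1 are what [base] lacks. Given 3p <= 2n, the inequalities make the
    two windows disjoint parts of the path. *)
Definition gadget_ok (p : nat) (g : gadget) : bool :=
  let w1 := window1 (g_x g) (g_h g) in
  let w2 := window2 (g_t g) (g_y g) in
  let s1 := g_path1 g in let s2 := g_path2 g in
  let a0 : vertex := (false, 0%R) in
  [&& absz (g_missed g) == (2 * p).-1,
      [&& 2 * g_x g <= 3 * p, 2 * (g_h g + g_t g) <= 6 * p
        & 2 * (g_y g).+1 <= 3 * p],
      [&& s1 != [::], s2 != [::], head a0 s1 == head a0 w1
        & head a0 s2 == head a0 w2],
      (last a0 s1 == last a0 w1) && (last a0 s2 == last a0 w2),
      perm_eq (g_skipped g :: s1 ++ s2) ((true, -2)%R :: w1 ++ w2) &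
      perm_eq ((false, g_missed g) :: edges s1 ++ edges s2)
              ((false, 1)%R :: edges w1 ++ edges w2)].

Local Notation r z := (false, z%Z).
Local Notation f z := (true, z%Z).

(** The entries follow p = 1, 3, 4, ..., 40; the first one leaves the path unchanged. *)
Definition gadgets : seq gadget := [::
  Gadget 0 0 0 0 1 (f (-2)) [:: r 0] [:: f (-1)];
  Gadget 3 1 2 1 (-5) (r (-1))
    [:: r 3; r 0; f (-2); r (-2); r 1; f (-1); f 0]
    [:: f (-3); f (-4)];
  Gadget 1 1 2 3 (-7) (f (-2))
    [:: r 1; r 0; f (-4); f 1; r (-1); f (-1); f 0]
    [:: f (-3); f (-6)];
  Gadget 1 2 1 4 9 (f (-2))
    [:: r 1; r 0; f 0; f 1; f (-6); f (-1); f (-4); r 2]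
    [:: r (-1); f 3];
  Gadget 1 1 3 5 (-11) (f (-2))
    [:: r 1; f (-3); f (-4); f 1; r (-1); r 0; f (-6); f 3; f 0]
    [:: r (-3); f (-1); f (-8)];
  Gadget 1 2 3 6 13 (f (-2))
    [:: r 1; f (-3); r (-1); r 0; f 0; f (-1); f (-4); f 1; f (-6); f 3;
    f (-8); r 2]
    [:: r (-3); f 5];
  Gadget 1 1 4 7 (-15) (f (-2))
    [:: r 1; r 0; f (-8); f 5; f (-6); f 3; f 0]
    [:: f (-5); f (-4); f 1; r (-1); f (-1); r (-3); f (-3); f (-10)];
  Gadget 1 2 3 8 17 (f (-2))
    [:: r 1; r 0; f 0; f 5; f (-10); f (-1); f (-4); f (-3); r (-1); f 3;
    f (-8); r 2]
    [:: r (-3); f 1; f (-6); f 7];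
  Gadget 1 1 5 9 (-19) (f (-2))
    [:: r 1; f (-3); f (-4); f 1; r (-1); r 0; f (-10); f 7; f 0]
    [:: r (-5); f (-1); r (-3); f (-5); f (-8); f 5; f (-6); f 3; f (-12)];
  Gadget 1 2 4 10 21 (f 0)
    [:: r 1; f 1; f (-6); r 0; r (-3); f 3; f (-8); f (-3); r (-1); f (-1);
    f (-2); f 7; f (-12); f 5; f (-10); r 2]
    [:: f (-5); f (-4); f 9];
  Gadget 1 1 6 11 (-23) (f (-2))
    [:: r 1; r 0; f (-12); f 9; f (-10); f 7; f (-8); f 5; r (-5); f (-5);
    f (-4); f 1; f (-6); f 3; f 0]
    [:: f (-7); r (-1); f (-1); r (-3); f (-3); f (-14)];
  Gadget 1 4 3 12 25 (f 2)
    [:: r 1; f 5; f (-10); f (-1); f (-4); f 1; f (-6); r 4]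
    [:: r (-3); f 7; f (-12); f 9; f (-14); f 3; f (-8); r 2; f 0; r 0; r (-1);
    f (-3); f (-2); f 11];
  Gadget 1 1 7 13 (-27) (f (-2))
    [:: r 1; f (-7); r (-3); f (-1); r (-1); r 0; f (-14); f 11; f (-12); f 9;
    f (-10); f 7; f (-8); f 5; r (-5); f (-3); f (-4); f 1; f (-6); f 3; f 0]
    [:: r (-7); f (-5); f (-16)];
  Gadget 15 4 3 1 (-29) (r 1)
    [:: r 15; r (-2); r (-1); r (-14); r 13; r (-12); r 11; r (-10); r 9; r 4]
    [:: r (-3); r (-6); r 5; r (-4); r 3; f (-3); f 0; r 2; f 2; r (-8); r 7;
    f (-1); f (-2); r 0; f (-4)];
  Gadget 1 4 4 15 (-31) (f 0)
    [:: r 1; f (-1); f (-2); r 4]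
    [:: f (-5); f (-12); f 9; f (-14); f 11; f (-16); f 13; f (-6); f 3;
    f (-8); f 5; f 2; r 2; f (-10); f 7; r (-1); r 0; f (-4); f 1; r (-3);
    f (-3); f (-18)];
  Gadget 18 2 6 1 (-33) (r (-3))
    [:: r (-18); r 17; r (-8); r 7; r 2]
    [:: f (-7); r 1; r 0; f (-2); r (-6); r 5; f (-5); r (-5); r (-14); r 13;
    r (-16); r 15; r (-2); r (-1); f (-3); f 0; r (-12); r 11; r (-10); r 9;
    r (-4); r 3; f (-1); f (-4)];
  Gadget 1 4 5 17 (-35) (f (-4))
    [:: r 1; f 1; r (-3); f (-1); f (-8); f 5; f (-18); f 15; f (-16); f 13;
    f (-14); f 11; f 0; r 0; f (-6); f 3; f 2; r 2; f (-12); f 9; f (-10); f 7;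
    r (-1); r 4]
    [:: r (-5); f (-3); f (-2); f (-5); f (-20)];
  Gadget 3 4 3 19 37 (f (-2))
    [:: r 3; r (-2); f 2; f 15; f (-20); f (-3); r 1; r 2; f 0; f 3; f (-8);
    f 1; f (-6); f (-1); f (-4); r 0; r (-1); f 5; f (-10); r 4]
    [:: r (-3); f 9; f (-14); f 7; f (-12); f 13; f (-18); f 11; f (-16); f 17;
    f (-22)];
  Gadget 1 3 5 20 (-39) (f (-2))
    [:: r 1; f (-1); f (-20); f 17; f (-14); f 11; f (-12); f 9; f (-18); f 15;
    f 0; f 1; f (-6); f 3; r (-1); f (-3); f (-4); r 2; f (-8); f 5; f 2]
    [:: r (-5); r 0; f (-10); f 7; r (-3); f (-5); f (-16); f 13; f (-22);
    f 19];
  Gadget 21 7 3 2 (-41) (r 3)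
    [:: r 21; r (-8); r 7; r (-18); r 17; r (-20); r 19; r (-14); r 13; f (-1);
    f 2; r 6; f (-2); r (-2); f (-4); f (-3); f 4; r (-6); r 5; r 4; r (-1);
    r (-4); r 1; r (-16); r 15; r 2; f 0; r 0; f 6]
    [:: r (-3); r (-12); r 11; r (-10); r 9; f 1];
  Gadget 22 4 7 2 43 (r 1)
    [:: r (-22); r 17; r (-16); r 15; r (-14); r 21; r (-20); r 3; r 4]
    [:: r (-7); r (-2); r 9; r (-8); r 19; r (-18); r (-3); r (-4); f (-2);
    r 2; r (-1); f (-1); f 2; f (-7); r 11; r (-10); f (-4); r 0; r 7; r (-6);
    r 13; r (-12); f 0; f (-5); r (-5); f (-3); r 5; f 1];
  Gadget 1 6 8 22 45 (f (-4))
    [:: r 1; f 5; f (-10); f 11; f (-16); f 17; f (-22); f 19; f (-24); f 13;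
    f (-18); f 7; f (-12); f 1; f (-6); f (-5); f 0; f (-3); r (-5); f 3;
    r (-3); f (-1); f (-2); f 15; f (-20); r 4; r (-7); f (-7); f 2; r 0; f 4;
    r 6]
    [:: f (-9); r (-1); f 9; f (-14); r 2; f (-8); f 21];
  Gadget 1 5 8 24 (-47) (f 0)
    [:: r 1; f 3; r (-1); f (-3); f (-2); r 0; f (-16); f 13; f (-10); f 7;
    r (-7); r 2; f (-14); f 11; f (-24); f 21; f (-22); f 19; f (-20); f 17;
    f 2; r 4; f 4]
    [:: f (-9); r (-5); f (-1); f (-12); f 9; f (-18); f 15; f (-4); f 1;
    f (-6); f (-7); r (-3); f (-5); f (-8); f 5; f (-26); f 23];
  Gadget 2 8 6 24 49 (f 2)
    [:: r (-2); r 1; f (-1); r (-1); f 15; f (-20); f 9; f (-14); r 2; f 0;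
    f 13; f (-18); f 3; f 4; r 4; f 6; r 6; r (-5); f 11; f (-16); f 21;
    f (-26); f 7; f (-12); f 5; f (-10); r 0; f (-4); r 8]
    [:: f (-7); f (-2); f (-3); r (-3); f (-5); f (-8); f 1; f (-6); f 19;
    f (-24); f 17; f (-22); f 23];
  Gadget 4 4 10 25 (-51) (f (-6))
    [:: r (-4); r (-1); r 4]
    [:: f (-11); f 2; f (-5); r (-5); f (-7); r 3; f 3; f (-20); f 17; f (-26);
    f 23; f (-16); f 13; r (-9); f (-9); r (-7); f (-1); f 0; r 0; f (-14);
    f 11; f (-24); f 21; f (-10); f 7; f (-8); f 1; f (-4); r 2; r 1; r (-2);
    f (-18); f 15; f (-12); f 9; f (-2); f 5; r (-3); f (-3); f (-22); f 19;
    f (-28)];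
  Gadget 1 7 10 26 53 (f (-2))
    [:: r 1; f 7; f (-12); r 6; f 4; f (-7); f 6]
    [:: f (-11); r (-7); f (-9); r (-5); f 17; f (-22); f 23; f (-28); f 21;
    f (-26); f 15; f (-20); f 9; f (-14); f 11; f (-16); f 5; f (-10); f (-5);
    f (-6); f 3; f (-4); f 13; f (-18); f 19; f (-24); r 4; f 2; r 2; f 0;
    f (-3); r (-9); f (-1); r (-3); f 1; r (-1); r 0; f (-8); f 25];
  Gadget 2 5 7 28 (-55) (f 2)
    [:: r (-2); f (-6); f 3; r 1; r 0; f (-2); r 4; f (-4); f (-7); r (-3);
    r 2; f (-16); f 13; r (-5); f (-1); f (-8); f 5; f (-22); f 19; f (-12);
    f 9; f (-10); f 7; r (-1); f (-3); f (-14); f 11; f (-24); f 21; f (-18);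
    f 15; f 0; f 1; f 4]
    [:: r (-7); f (-5); f (-28); f 25; f (-26); f 23; f (-20); f 17; f (-30);
    f 27];
  Gadget 2 10 5 29 57 (f (-6))
    [:: r (-2); f (-4); r 0; r 1; r 4; f 0; f (-1); r (-1); f 7; f (-12); f 21;
    f (-26); f 19; f (-24); f 13; f (-18); f 23; f (-28); f 25; f (-30);
    f (-5); r (-3); f 5; f (-10); f 11; f (-16); r 6; f 4; f (-3); f 2; f 15;
    f (-20); f 9; f (-14); f 3; f (-8); f 1; f (-2); r 2; f 6; r 8; f 8; r 10]
    [:: r (-5); f 17; f (-22); f 27; f (-32)];
  Gadget 1 8 9 30 (-59) (f (-8))
    [:: r 1; f 3; f (-4); f 5; f (-18); f 15; f 0; r 2; f (-14); f 11; f (-24);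
    f 21; f (-30); f 27; f (-12); f 9; f (-22); f 19; f (-28); f 25; f 6; r 8]
    [:: r (-9); f (-9); f 4; r 6; f 2; r 4; f (-6); f (-7); r (-7); f (-1);
    r (-3); f (-3); f (-2); f (-5); r (-5); r 0; f (-16); f 13; r (-1); f 1;
    f (-10); f 7; f (-20); f 17; f (-26); f 23; f (-32); f 29];
  Gadget 1 6 13 31 61 (f (-6))
    [:: r 1; f 9; f (-14); f 15; f (-20); f 17; f (-22); f 27; f (-32); f 21;
    f (-26); f 19; f (-24); r 0; r (-3); f 3; r (-1); f (-1); f 4; f (-11);
    r (-11); f (-9); r (-9); f (-7); r (-7); f (-5); f (-4); f 5; f (-2);
    f (-3); r (-5); f 13; f (-18); f 7; f (-12); r 2; f (-8); f 25; f (-30);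
    f 11; f (-16); f 1; f (-10); r 6]
    [:: r (-13); f (-13); f 0; r 4; f 2; f 23; f (-28); f 29; f (-34)];
  Gadget 3 13 9 32 (-63) (f (-6))
    [:: r 3; f 1; r (-5); f 7; f 4; r 4; f 2; f (-5); f (-28); f 25; f (-10);
    f (-1); r (-1); r 0; f 0; f 3; f (-12); f 9; f (-2); f (-7); r (-7);
    f (-3); f (-4); r (-2); f (-14); f 11; f (-8); f 5; f (-22); f 19; f (-32);
    f 29; f (-30); f 27; f (-20); f 17; f (-26); f 23; f (-16); f 13; f (-18);
    f 15; r 1; f (-9); r (-3); r 2; f 8; r 10; f 10; r 12; f 12]
    [:: r (-9); r 8; f 6; r 6; f (-24); f 21; f (-34); f 31];
  Gadget 34 8 10 5 (-65) (r 5)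
    [:: r (-34); r 33; r (-24); r 23; r (-22); r 21; r (-32); r 31; r (-30);
    r 29; r (-20); r 19; f (-5); r (-5); r (-26); r 25; r (-12); r 11; r (-6);
    f (-6); r (-2); f (-2); r (-18); r 17; r (-16); r 15; r (-14); r 13;
    r (-28); r 27; r 2; r (-7); f (-7); f 2; f (-9); r (-9); r (-10); r 9;
    r (-4); r 7; r 0; r 1; r 8]
    [:: f (-11); f 4; r 4; f 6; r 6; f 0; f 3; r (-1); f (-1); f (-4); f 1;
    r 3; f (-3); r (-3); r (-8); f (-8)];
  Gadget 4 7 10 34 (-67) (f 2)
    [:: r (-4); f (-2); f (-3); r (-1); f 1; f (-22); f 19; r (-7); r 6;
    f (-26); f 23; f (-32); f 29; f (-34); f 31; f (-28); f 25; f (-18); f 15;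
    f (-16); f 13; r (-3); r 4; r 1; f (-9); r (-9); f (-5); r 3; f 5; f 0;
    r 2; f 4; f (-7); f (-6); f 3; f (-4); f (-1); f (-20); f 17; f (-10); f 7;
    f (-8); r (-2); f 6]
    [:: f (-11); r (-5); r 0; f (-12); f 9; f (-30); f 27; f (-24); f 21;
    f (-14); f 11; f (-36); f 33];
  Gadget 2 15 2 34 69 (f (-4))
    [:: r (-2); f 2; r 0; r 1; f 11; f (-16); f 1; f (-6); r 4; f 0; f 5;
    f (-10); f 3; f (-8); f 13; f (-18); f 7; f (-12); f 21; f (-26); f 23;
    f (-28); f 25; f (-30); f (-1); f (-2); r 8; f 8; r 6; f 4; r 14; f 14]
    [:: f (-3); f 6; r 2; r (-1); f 27; f (-32); f 29; f (-34); f 31; f (-36);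
    f 9; f (-14); r 10; f 10; r 12; f 12; f 15; f (-20); f 17; f (-22); f 19;
    f (-24); f 33];
  Gadget 8 8 8 36 (-71) (f 4)
    [:: r (-8); f (-4); r (-4); r 5; r 0; r (-7); r 8]
    [:: f (-9); f (-6); f (-1); f (-20); f 17; f (-30); f 27; f (-36); f 33;
    f (-34); f 31; f (-28); f 25; f (-26); f 23; f (-32); f 29; f 2; f 1; r 3;
    r 4; r (-5); r 6; f (-12); f 9; f (-22); f 19; f (-24); f 21; f (-18);
    f 15; f (-8); r (-6); r 1; f 5; f (-10); f 7; r 7; f 3; r (-3); f (-7);
    f 6; r 2; f 0; r (-2); f (-14); f 11; f (-2); f (-5); f (-16); f 13;
    r (-1); f (-3); f (-38); f 35];
  Gadget 3 7 10 37 73 (f (-6))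
    [:: r 3; f 5; f (-10); f 3; f (-8); f 21; f (-26); f 27; f (-32); f 33;
    f (-38); f 31; f (-36); f 25; f (-30); f (-9); f (-4); r 2; r 1; f 1; f 4;
    f (-3); r (-5); f 11; f (-16); r (-2); f (-2); r 6; f 6]
    [:: f (-11); r (-9); f (-1); f 0; r 0; r (-3); f 13; f (-18); f 7; f (-12);
    f 29; f (-34); f 23; f (-28); f 17; f (-22); f 15; f (-20); r 4; r (-1);
    f (-5); r (-7); f (-7); f 2; f 19; f (-24); f 9; f (-14); f 35; f (-40)];
  Gadget 39 9 17 2 75 (r (-5))
    [:: r 39; r (-38); r 29; r (-28); r 27; r (-26); r 37; r (-36); r 35;
    r (-34); r 25; r (-24); r 23; r (-22); r 13; r (-12); r 11; r (-10); r 33;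
    r (-32); f (-2); r 8; f 2; f (-15); r (-15); f (-17); r (-9); f (-7); f 4;
    r (-2); r (-7); f (-1); r 17; r (-16); r 15; r (-14); r 1; r 0; r 5; r 2;
    r 3; f (-3); r (-1); r 6; r 9; r (-4); r (-13); f (-5); r 19; r (-18);
    f (-4); r (-6); f 0; r 4; f 8]
    [:: r (-17); f (-11); r (-3); f (-9); r (-11); f (-13); f 6; r (-8); r 31;
    r (-30); r 21; r (-20); r 7; f 1];
  Gadget 40 14 8 1 (-77) (r (-3))
    [:: r (-40); r 39; r (-34); r 33; r (-8); f 0; r 6; r (-7); r (-10); r 9;
    r (-16); r 15; r (-22); r 21; r 0; f 2; r (-18); r 17; r (-28); r 27;
    r (-2); r 1; f (-5); r (-1); r 10; f (-2); r (-12); r 11; r (-38); r 37;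
    r (-32); r 31; r (-26); r 25; r (-36); r 35; r (-30); r 29; r (-24); r 23;
    f (-1); r 5; r (-4); r (-5); f (-7); f 8; r 12; f 12; r 14]
    [:: f (-9); r 7; r 2; r 3; r (-14); r 13; r (-20); r 19; f (-3); f 4; r 8;
    f 10; r 4; f 6; r (-6); f (-4)];
  Gadget 41 18 6 1 79 (r (-1))
    [:: r 41; r (-40); r 19; r (-18); r 13; r (-12); r 11; r (-10); r 5;
    r (-4); f (-2); r 2; f 6; r 4; r 15; r (-14); f 2; f (-1); r 17; r (-16);
    r 3; r 10; f 8; r 6; f 0; f (-5); r 25; r (-24); r 31; r (-30); r 33;
    r (-32); r 7; r (-6); f 10; r 12; f 12; r 14; f 14; r 16; f 16; r 18]
    [:: f (-7); r (-3); r (-2); f 4; r 8; r 35; r (-34); r 37; r (-36); r 39;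
    r (-38); r 29; r (-28); r 23; r (-22); r 21; r (-20); r 27; r (-26); r 9;
    r (-8); r (-5); f (-3); r 1; r 0; f (-4)]].


Lemma gadgets_ok : all (fun p => has (gadget_ok p) gadgets) (1 :: iota 3 38).
Proof. by vm_compute. Qed.

(** * The permuted alternating walk for p = 2 *)

Fixpoint straight (k : nat) (e : int) : seq vertex :=
  [:: (false, e), (true, e), (false, e + 2)%R, (true, e + 2)%R &
   if k is k'.+1 then straight k' (e + 4)%R
   else [:: (false, e + 4)%R; (true, e + 4)%R]].

(* With the vertices of a block numbered r0 r1 | f0 f1, the walk r0 f0 r1 f1
   becomes r1 f1 r0 f0; the last block r0 f0 r1 f1 r2 f2 becomes r1 f2 r2 f0 r0 f1. *)
Fixpoint twisted (k : nat) (e : int) : seq vertex :=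
  if k is k'.+1 then
    [:: (false, e + 2)%R, (true, e + 2)%R, (false, e), (true, e) &
     twisted k' (e + 4)%R]
  else [:: (false, e + 2)%R; (true, e + 4)%R; (false, e + 4)%R; (true, e);
           (false, e); (true, e + 2)%R].

Lemma twisted_perm k e : perm_eq (twisted k e) (straight k e).
Proof.
elim: k e => [|k IHk] e; apply/seq.permP => a /=; first ring.
rewrite (seq.permP (IHk (e + 4)%R) a).
ring.
Qed.

(** Inside a block the label sums are only permuted. Between blocks e + (e + 6) = (e + 2) + (e + 4),
    and the final link to [t] changes from -3 to -1. *)
Lemma twisted_edges k e :
  let t := (true, e + (4 * k + 1)%:Z)%R in
  perm_eq ((false, -3)%R :: edges (rcons (twisted k e) t))
          ((false, -1)%R :: edges (rcons (straight k e) t)).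
Proof.
move=> /=; elim: k e => [|k IHk] e; apply/seq.permP => a.
  rewrite /= /edge /=.
  have -> : (e + 4 + e = e + 2 + (e + 2))%R by lia.
  have -> : (e + (4 * 0 + 1)%N%:Z - (e + 4) = -3)%R by lia.
  have -> : (e + (4 * 0 + 1)%N%:Z - (e + 2) = -1)%R by lia.
  ring.
have -> : (e + (4 * k.+1 + 1)%N%:Z = e + 4 + (4 * k + 1)%:Z)%R by lia.
have key (c d x y b1 b2 b3 b4 : nat) : c + x = d + y ->
  c + (b1 + (b2 + (b3 + (b4 + x)))) = d + (b3 + (b2 + (b1 + (b4 + y)))) by lia.
have /seq.permP/(_ a) := IHk (e + 4)%R.
have e1 : (e + (e + 4 + 2) = e + 2 + (e + 4))%R by lia.
have e2 : (e + 2 + e = e + (e + 2))%R by lia.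
by case: k {IHk} => [|k] /=; rewrite /edge /= e1 e2; apply: key.
Qed.

Lemma straight_alab k i :
  straight k (i.*2)%:Z%R = [seq alab j | j <- iota i.*2 (4 * k + 6)].
Proof.
elim: k i => [|k IHk] i.
  rewrite /= /alab /= !odd_double /= !uphalf_double !doubleK.
  have -> : (i.*2%:Z + 2 = (i.+1).*2%:Z)%R by lia.
  by have -> : (i.*2%:Z + 4 = (i.+2).*2%:Z)%R by lia.
have -> : 4 * k.+1 + 6 = (4 * k + 6).+4 by lia.
rewrite /= -[i.*2.+4]/(i.+2).*2 -IHk /alab /= !odd_double /=.
rewrite !uphalf_double !doubleK.
have -> : ((i.+2).*2%:Z = i.*2%:Z + 4)%R by lia.
by have -> : (i.*2%:Z + 2 = (i.+1).*2%:Z)%R by lia.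
Qed.

Lemma rev_iota T (h : nat -> T) k :
  rev [seq h i | i <- iota 0 k.+1] = [seq h (k - i) | i <- iota 0 k.+1].
Proof.
apply: (@eq_from_nth _ (h 0)) => [|i]; rewrite size_rev !size_map size_iota // => lt_i.
rewrite nth_rev size_map size_iota // !(nth_map 0) ?size_iota ?nth_iota //; lia.
Qed.

Lemma map_iota_shift T (h : nat -> T) a b k :
  [seq h j | j <- iota (a + b) k] = [seq h (a + j) | j <- iota b k].
Proof. by rewrite iotaDl -map_comp. Qed.

(** * Carrying out the local changes in the path *)

Section Windows.

Variables (gT : finGroupType) (G : {group gT}) (u v : gT) (n : nat).
Let m := (n.*2).+1.
Hypothesis n_gt1 : 1 < n.
Hypothesis n_even : ~~ odd n.
Local Open Scope group_scope.
Hypothesis um : u ^+ m = 1.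
Hypothesis vv : v * v = 1.
Hypothesis vuv : v * u = u^-1 * v.
Hypothesis Guv : forall x, x \in G -> exists d : vertex, x = delt u v m d.
Hypothesis cG : #|G| = (2 * m)%N.

Local Notation vert := (vert u v m).
Local Notation delt := (delt u v m).

Lemma vert_tlab i : i <= n.*2.+1 -> vert (alab (n.*2.+1 - i)) = vert (tlab i).
Proof.
move=> le_i; rewrite /alab /tlab oddB //= odd_double /=.
by apply: (@vert_eq _ u v n); exists 1%R; lia.
Qed.

Lemma map_window1 a h : a <= n -> h <= n.*2 ->
  [seq blab n j | j <- iota (n - a) (a.+1 + h)] = window1 a h.
Proof.
move=> le_a le_h; rewrite /window1 iotaD map_cat rev_iota; congr (_ ++ _).
  rewrite -{1}[n - a]addn0 map_iota_shift; apply/eq_in_map => i.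
  rewrite mem_iota => lt_i; have -> : n - a + i = n - (a - i) by lia.
  by rewrite blab_x //; lia.
have -> : n - a + a.+1 = n + 1%N by lia.
rewrite map_iota_shift; apply/eq_in_map => i; rewrite mem_iota => lt_i.
by rewrite blab_a //; lia.
Qed.

(** Equality holds only after applying [vert], since [tlab] carries labels reduced modulo 2n + 1. *)
Lemma map_window2 b c : b <= n.*2 ->
  [seq vert (blab n j) | j <- iota ((3 * n).+1 - b) (b.+1 + c)]
  = [seq vert a | a <- window2 b c].
Proof.
move=> le_b; rewrite /window2 iotaD !map_cat rev_iota -!map_comp; congr (_ ++ _).
  rewrite -{1}[(3 * n).+1 - b]addn0 map_iota_shift; apply/eq_in_map => i.
  rewrite mem_iota /= => lt_i.
  have -> : ((3 * n).+1 - b + i = n + (n.*2.+1 - (b - i)))%N by lia.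
  by rewrite blab_a ?vert_tlab //; lia.
have -> : ((3 * n).+1 - b + b.+1 = (3 * n).+1 + 1%N)%N by lia.
rewrite map_iota_shift; apply/eq_in_map => i; rewrite mem_iota => lt_i.
by rewrite /= blab_y //; lia.
Qed.

Lemma base_windows a h b c : a <= n -> h + b <= n.*2 -> c < n ->
  exists A B C, [seq vert x | x <- base n] =
    A ++ [seq vert x | x <- window1 a h] ++
    B ++ [seq vert x | x <- window2 b c] ++ C.
Proof.
move=> le_a le_hb lt_c.
exists [seq vert (blab n j) | j <- iota 0 (n - a)].
exists [seq vert (blab n j) | j <- iota (n + h.+1) (n.*2 - b - h)].
exists [seq vert (blab n j) | j <- iota ((3 * n).+2 + c) (n.-1 - c)].
rewrite -map_window1 -?map_window2 /base -?map_comp; try lia.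
have -> : ((4 * n).+1 = (n - a) + ((a.+1 + h) + ((n.*2 - b - h) +
  ((b.+1 + c) + (n.-1 - c)))))%N by lia.
rewrite !iotaD !map_cat add0n; do !congr (_ ++ _); do !congr (map _ _);
  congr iota; lia.
Qed.

Lemma gadget_near_perfect p g : gadget_ok p g -> 3 * p <= 2 * n ->
  exists z s, near_perfect G (delt (false, g_missed g)) z s.
Proof.
case: g => a h b c d z s1 s2; rewrite /gadget_ok /=.
set w1 := window1 a h; set w2 := window2 b c.
case/and5P=> _ /and3P[le_a le_hb le_c] /and4P[s1n s2n h1 h2] /andP[l1 l2].
case/andP=> pv pe le_p.
exists (vert z).
have [A [B [C eN]]] : exists A B C, [seq vert x | x <- base n] =
    A ++ [seq vert x | x <- w1] ++ B ++ [seq vert x | x <- w2] ++ C.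
  by apply: base_windows; lia.
exists (A ++ map vert s1 ++ B ++ map vert s2 ++ C).
have := base_near_perfect n_gt1 n_even um vv vuv Guv cG; rewrite eN.
have {}pe : perm_eq
    (delt (false, d) :: quotients (map vert s1) ++ quotients (map vert s2))
    (delt (false, 1)%R :: quotients (map vert w1) ++ quotients (map vert w2)).
  by rewrite !(quotients_vert _ um) // -!map_cat; apply: (perm_map delt pe).
have {}pv : perm_eq (vert z :: map vert s1 ++ map vert s2)
    (vert (true, -2)%R :: map vert w1 ++ map vert w2).
  by rewrite -!map_cat; apply: (perm_map vert pv).
have w1n : size w1 != 0%N by rewrite size_cat size_rev size_map size_iota; lia.
have w2n : size w2 != 0%N by rewrite size_cat size_rev size_map size_iota; lia.
case: w1 w2 w1n w2n h1 h2 l1 l2 pv pe {eN} => [|x1 w1] // [|x2 w2] // _ _.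
case: s1 s2 s1n s2n => [|y1 s1] // [|y2 s2] // _ _.
move=> /eqP/= -> /eqP/= -> /eqP/= l1 /eqP/= l2.
by apply: near_perfect_swap; rewrite !last_map ?l1 ?l2.
Qed.

(** Twisting turns the link from [xlab 1] into the walk from -1 to 1 and the link out of it from -3
    to -1. The missing rotation thus moves from 1 to -3, as p = 2 demands. *)
Lemma twisted_near_perfect : 3 < n ->
  exists z s, near_perfect G (delt (false, -3)%R) z s.
Proof.
move=> n_gt3; exists (vert (true, -2)%R).
(* As [n] is even, 4k + 6 = 2n + 2 is the length of the whole walk. [t] is [ylab 1] with its label
   -4 raised by 2n + 1. The second window is the single vertex [ylab 2]. *)
pose k := n.-2./2; pose t : vertex := (true, (0 + (4 * k + 1)%:Z)%R).
have eN : [seq vert x | x <- base n] =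
    [seq vert (blab n j) | j <- iota 0 n.-1] ++
    (vert (xlab 1) :: map vert (rcons (straight k 0%R) t)) ++ [::] ++
    (vert (ylab 2) :: [::]) ++
    [seq vert (blab n j) | j <- iota (3 * n).+4 (n - 3)].
  have [K eK ->] : exists2 K, K = n.*2.+2 &
      straight k 0%R = [seq alab j | j <- iota 0 K].
    by exists (4 * k + 6)%N; [rewrite /k; lia | exact: (straight_alab k 0)].
  rewrite /base; have -> : (4 * n).+1 = (n.-1 + (1 + (K + (2 + (n - 3)))))%N by lia.
  rewrite !iotaD !map_cat add0n -!map_comp; congr (_ ++ _) => /=.
  have -> : n.-1 = (n - 1)%N by lia.
  rewrite blab_x; last by lia.
  congr (_ :: _).
  have -> : (n - 1 + 1 = n + 0)%N by lia.
  rewrite map_iota_shift map_rcons cat_rcons -map_comp; congr (_ ++ _).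
    apply/eq_in_map => i; rewrite mem_iota => lt_i.
    by rewrite /= blab_a //; lia.
  have -> : (n + 0 + K = (3 * n).+1 + 1)%N by lia.
  rewrite -addnS !blab_y //; congr [:: _, _ & _].
    by apply: (@vert_eq _ u v n); exists (- 1)%R; rewrite /k; lia.
  by congr (map _ (iota _ _)); lia.
have := base_near_perfect n_gt1 n_even um vv vuv Guv cG; rewrite eN => bN.
eexists; apply: (near_perfect_swap (V := map vert (rcons (twisted k 0%R) t))
  (V' := [::]) _ _ _ _ bN) => //.
- by rewrite !map_rcons !last_rcons.
- rewrite perm_cons perm_cat2r perm_cons; apply: perm_map.
  by rewrite perm_rcons perm_sym perm_rcons perm_cons perm_sym twisted_perm.
have es : edges (xlab 1 :: rcons (straight k 0%R) t) =
    (false, -1)%R :: edges (rcons (straight k 0%R) t) by case: (k).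
have et : edges (xlab 1 :: rcons (twisted k 0%R) t) =
    (false, 1)%R :: edges (rcons (twisted k 0%R) t) by case: (k).
rewrite !cats0 -!map_cons !(quotients_vert _ um) // es et -!map_cons.
apply: perm_map; rewrite (perm_catCA [:: _] [:: _]) perm_cons.
exact: twisted_edges.
Qed.

End Windows.

(** * Units modulo m and residues with equal gcd *)

Lemma coprime_lift c m s : 0 < m -> 0 < s -> coprime c s ->
  exists2 t, coprime m t & t = s %[mod c].
Proof.
(* A prime divisor of [m] divides exactly one of the two summands: [s], or the part of [m] prime to
   [s]. *)
move=> m_gt0 s_gt0 co_cs; exists (s + c * m`_(\pi(s)^')); last first.
  by rewrite mulnC addnC modnMDl.
rewrite coprime_sym; apply: contraT => nco.
have [q q_pr /andP[q_t q_m]] : exists2 q,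
    prime q & (q %| s + c * m`_(\pi(s)^')) && (q %| m).
  exists (pdiv (gcdn (s + c * m`_(\pi(s)^')) m)).
    by rewrite pdiv_prime // ltn_neqAle eq_sym nco gcdn_gt0 m_gt0 orbT.
  by rewrite -dvdn_gcd pdiv_dvd.
have [q_s|q_s] := boolP (q %| s).
  have := q_t; rewrite dvdn_addr // Euclid_dvdM // => /orP[q_c|].
    have : q %| gcdn c s by rewrite dvdn_gcd q_c.
    by rewrite (eqP co_cs) dvdn1 => /eqP q1; rewrite q1 in q_pr.
  move=> q_mp; have := part_pnat (\pi(s)^') m.
  move/pnatP => /(_ (part_gt0 _ _) q q_pr q_mp).
  by rewrite !inE /= mem_primes q_pr s_gt0 q_s.
have q_mp : q %| m`_(\pi(s)^').
  move: q_m; rewrite -{1}(partnC \pi(s) m_gt0) Euclid_dvdM // => /orP[q_mp|//].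
  have := part_pnat \pi(s) m; move/pnatP => /(_ (part_gt0 _ _) q q_pr q_mp).
  by rewrite mem_primes (negPf q_s) !andbF.
by move: q_t; rewrite addnC dvdn_addr ?dvdn_mull // (negPf q_s).
Qed.

(** Divided by the common gcd, [a] and [b] become units modulo the cofactor [c] of [m]; their ratio
    lifts to a unit modulo [m]. *)
Lemma eq_gcdn_unit m a b : 0 < m -> gcdn m a = gcdn m b ->
  exists2 t, coprime m t & a = t * b %[mod m].
Proof.
move=> m_gt0 eg.
have g_gt0 : 0 < gcdn m b by rewrite gcdn_gt0 m_gt0.
have [[c ec] [b' eb]] := (dvdnP (dvdn_gcdl m b), dvdnP (dvdn_gcdr m b)).
have [a' ea] : exists a', a = a' * gcdn m b.
  by apply/dvdnP; rewrite -eg dvdn_gcdr.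
set g := gcdn m b in g_gt0 ec eb ea eg.
have co x : gcdn m (x * g) = g -> coprime c x.
  by rewrite ec -muln_gcdl -[RHS]mul1n => /eqP; rewrite eqn_pmul2r.
have co_b : coprime c b' by apply: co; rewrite -eb.
have co_a : coprime c a' by apply: co; rewrite -ea.
have c_gt0 : 0 < c by move: m_gt0; rewrite ec muln_gt0 => /andP[].
have [y ey] : exists y, b' * y = 1 %[mod c].
  (* If b' = 0, coprimality forces c = 1. *)
  have [e|b_gt0] := posnP b'.
    by exists 0; move: co_b; rewrite e /coprime gcdn0 => /eqP->; rewrite !modn1.
  have [y z ey _] := egcdnP c b_gt0.
  by exists y; rewrite mulnC ey gcdnC (eqP co_b) modnMDl.
have co_y : coprime c y.
  have : coprime c (b' * y) by rewrite -coprime_modr ey coprime_modr coprimen1.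
  by rewrite coprimeMr => /andP[].
(* Adding [c] keeps the residue and ensures positivity. *)
have [|||t co_t et] := @coprime_lift c m (a' * y + c) => //.
- by rewrite addn_gt0 c_gt0 orbT.
- by rewrite -coprime_modr modnDr coprime_modr coprimeMr co_a.
exists t => //; rewrite ea [in RHS]eb mulnA ec -!muln_modl; congr (_ * _).
rewrite -modnMml et modnDr modnMml -mulnA (mulnC y) -modnMmr ey modnMmr.
by rewrite muln1.
Qed.

(** * From the given dihedral group to labels, and the conclusion *)

Section DihedralGroup.
Local Open Scope group_scope.

Lemma dihedral_mulg (gT : finGroupType) (G : {group gT}) (m : nat) (u v : gT) :
  0 < m -> is_dihedral G m u v ->
  [/\ v * v = 1, v * u = u^-1 * v & G :=: <[u]> * <[v]>].
Proof.
move=> m_gt0 [eG ou ov vu cG].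
have vv : v * v = 1 by rewrite -expg2 -ov expg_order.
have uV : u ^+ m.-1 = u^-1 by rewrite invg_expg ou.
have vuv : v * u = u^-1 * v by rewrite vu uV.
split=> //; rewrite eG.
have nuv : <[v]> \subset 'N(<[u]>).
  rewrite cycle_subG inE -cycleJ cycle_subG conjgE.
  have -> : v^-1 = v by apply/eqP; rewrite eq_invg_mul vv.
  by rewrite mulgA vuv -mulgA vv mulg1 groupV cycle_id.
by rewrite -(norm_joinEr nuv) joing_idl joing_idr.
Qed.

Lemma dihedral_delt (gT : finGroupType) (G : {group gT}) (m : nat) (u v : gT) x :
  u ^+ m = 1 -> v * v = 1 -> G :=: <[u]> * <[v]> -> x \in G ->
  exists d : vertex, x = delt u v m d.
Proof.
move=> um vv -> /mulsgP[y z /cycleP[i ->] /cycleP[j ->] ->].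
exists (odd j, i%:Z%R); rewrite /delt upow_nat //=.
have -> : v ^+ j = if odd j then v else 1.
  rewrite -[in v ^+ j](odd_double_half j) -muln2 mulnC expgD expgM expg2 vv expg1n.
  by rewrite mulg1; case: odd.
by case: odd; rewrite ?mulg1.
Qed.

Lemma gadget_exists p : 0 < p <= 40 -> p != 2 -> exists g, gadget_ok p g.
Proof.
move=> le_p ne_p; have : has (gadget_ok p) gadgets.
  by apply: (allP gadgets_ok); rewrite inE mem_iota; lia.
by elim: gadgets => //= g gs IHgs /orP[ok_g | /IHgs //]; exists g.
Qed.

End DihedralGroup.

Theorem theorem5p4 (l p q : nat) (r : int)
  (gT : finGroupType) (G : {group gT}) (u v : gT) (S : {set gT}) :
  (0 < l)%N -> (0 < p)%N -> (0 < q)%N ->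
  ((2 * l)%N%:Z = (p * q)%N%:Z + r)%R ->
  (p%:Z <= 2 * r)%R -> (r <= 20)%R ->
  is_dihedral G (4 * l + 1) u v ->
  S \subset (G :\ 1%g) -> #|S| = (8 * l)%N ->
  (forall x : gT, x \in G -> x != 1%g -> x \notin S ->
     #[x]%g = #[u ^+ (2 * l - p + 1)]%g) ->
  has_S_sequencing S.
Proof.
move=> l_gt0 p_gt0 q_gt0 def_l le_pr le_r20 dihG sSG cS missing.
have le_pq : p <= p * q by rewrite leq_pmulr.
(* 2l = pq + r >= p + p/2; likewise p <= 2r <= 40. *)
have le_p : 3 * p <= 4 * l by lia.
have le_p40 : p <= 40 by lia.
pose n := (2 * l)%N; have em : (4 * l + 1 = n.*2.+1)%N by rewrite /n; lia.
have n_gt1 : 1 < n by rewrite /n; lia.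
have n_even : ~~ odd n by rewrite /n oddM.
rewrite em in dihG; have [_ ou _ _ cG] := dihG.
have [//|vv vuv eG] := dihedral_mulg _ dihG.
have [S1 sSG'] : (1%g \notin S) /\ S \subset G.
  have := subsetD1P sSG; by case=> ? ?; split.
have /subsetPn[w wG] : ~~ (G \subset 1%g |: S).
  by apply/negP => /subset_leq_card; rewrite cardsU1 S1 cS cG /n; lia.
rewrite !inE negb_or => /andP[w1 Sw].
have um : (u ^+ n.*2.+1 = 1)%g by rewrite -ou expg_order.
(* A reflection has order dividing 2, whereas the order of [w] divides the odd number 2n + 1. *)
have [a ea] : exists a, w = (u ^+ a)%g.
  have [[[] d] ew] := dihedral_delt um vv eG wG; last by eexists; exact: ew.
  have ww : (w ^+ 2 = 1)%g.
    rewrite ew /delt /upow /= expg2 -mulgA (mulgA v) power_inverted // -mulgA vv.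
    by rewrite mulg1 mulgV.
  have o2 : #[w]%g %| 2 by rewrite order_dvdn ww.
  have om : #[w]%g %| n.*2.+1 by rewrite missing // -ou orderXdvd.
  have : #[w]%g %| gcdn 2 n.*2.+1 by rewrite dvdn_gcd o2.
  have -> : gcdn 2 n.*2.+1 = 1%N.
    by apply/eqP; rewrite -/(coprime _ _) coprime2n /= odd_double.
  by rewrite dvdn1 order_eq1 (negPf w1).
have [t co_t et] : exists2 t,
    coprime n.*2.+1 t & a = t * (2 * p).-1 %[mod n.*2.+1].
  apply: eq_gcdn_unit => //.
  have := missing w wG w1 Sw; rewrite ea !orderXgcd ou => eo.
  have eg : gcdn n.*2.+1 a = gcdn n.*2.+1 (2 * l - p + 1).
    have [d1 d2] := (dvdn_gcdl n.*2.+1 a, dvdn_gcdl n.*2.+1 (2 * l - p + 1)).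
    apply/eqP; rewrite -(@eqn_pmul2l (n.*2.+1 %/ gcdn n.*2.+1 a)).
      by rewrite {2}eo mulnC divnK // mulnC divnK.
    by rewrite divn_gt0 ?gcdn_gt0 // dvdn_leq.
  (* Doubling n - p + 1 keeps its gcd with the odd modulus 2n + 1 = 2(n - p + 1) + (2p - 1). *)
  rewrite eg -(@Gauss_gcdr _ 2).
    have -> : n.*2.+1 = 2 * (2 * l - p + 1) + (2 * p).-1 by rewrite /n; lia.
    by rewrite gcdnC gcdnDl [in RHS]gcdnC gcdnDr gcdnC.
  by rewrite coprimen2 /= odd_double.
have [d ed main] : exists2 d : int, absz d = (2 * p).-1 & forall u1 : gT,
    <[u1]>%g = <[u]>%g -> (u1 ^+ n.*2.+1)%g = 1%g -> (v * u1 = u1^-1 * v)%g ->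
    exists z s, near_perfect G (delt u1 v n.*2.+1 (false, d)) z s.
  have [p2|p2] := eqVneq p 2.
    exists (-3)%R; first by rewrite p2.
    move=> u1 eu1 u1m vu1; apply: twisted_near_perfect => //; last by rewrite /n; lia.
    by move=> x; apply: dihedral_delt; rewrite ?eu1.
  have [|//|g ok_g] := @gadget_exists p; first by lia.
  exists (g_missed g); first by case/and5P: ok_g => /eqP.
  move=> u1 eu1 u1m vu1; apply: (gadget_near_perfect _ _ _ _ _ _ _ ok_g) => //.
    by move=> x; apply: dihedral_delt; rewrite ?eu1.
  by rewrite /n; lia.
have eut : <[u ^+ t]>%g = <[u]>%g.
  by apply/esym/eqP; have := generator_coprime u t; rewrite ou co_t.
have utm : ((u ^+ t) ^+ n.*2.+1 = 1)%g by rewrite -expgM mulnC expgM um expg1n.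
have vut := power_inverted t vuv.
have ew : ((u ^+ t) ^+ (2 * p).-1)%g = w.
  by rewrite -expgM ea -[LHS](expg_mod _ um) -et expg_mod.
(* Inverting the generator absorbs the sign of [d]: the rotation labelled [d] is then [w] itself. *)
pose u1 := if (0 <= d)%R then (u ^+ t)%g else ((u ^+ t)^-1)%g.
have [|||z [s ns]] := main u1.
- by rewrite /u1; case: ifP => _; rewrite ?cycleV.
- by rewrite /u1; case: ifP => _; rewrite ?expVgn utm ?invg1.
- rewrite /u1; case: ifP => _ //; rewrite invgK; apply: (mulIg (u ^+ t)%g).
  by rewrite mulgKV -mulgA vut mulKVg.
apply: (near_perfect_sequencing sSG' S1 wG w1 Sw _ _ (s := s) (z := z)).
  by rewrite cG cS /n; lia.
suff <- : delt u1 v n.*2.+1 (false, d) = w by [].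
rewrite /delt /u1 /= -ew -ed; case: (d) => b.
  by rewrite upow_nat.
rewrite NegzE upowN ?upow_nat ?expVgn ?invgK ?utm ?invg1 //.
Qed.
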